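(* Let $m$ and $n$ be positive integers. There exist $n$ linear orders $<_1,\ldots,<_n$ on the free abelian group $\mathbb{Z}^m$ of rank $m$, each of which is right-invariant, such that the $n$-order $(\mathbb{Z}^m;<_1,\ldots,<_n)$ is generic, if and only if $m>n$.
   Context: An $n$-order is a set carrying $n$ (strict) linear (total) orders $<_1,\ldots,<_n$, with no relationship assumed between them. Substructures are induced substructures. A relational structure is homogeneous if every isomorphism between finite substructures extends to an automorphism; the age of a structure is the class of all finite structures of the same type embeddable in it. The class of finite $n$-orders is a Fraïssé class; its Fraïssé limit, i.e. the unique (up to isomorphism) countable homogeneous $n$-order whose age is the class of all finite $n$-orders, is called the generic $n$-order, and an $n$-order is called generic if it is isomorphic to this one. Equivalently, an $n$-order on a countable set $X$ is generic if and only if it has the extension property: for any finite $n$-orders $A\subseteq B$ with $|B|=|A|+1$, every embedding of $A$ into $X$ extends to an embedding of $B$ into $X$. A linear order $<$ on a group $G$ is right-invariant if $x<y$ implies $xg<yg$ for all $g\in G$ (for $\mathbb{Z}^m$ written additively: $x<y$ implies $x+g<y+g$). *)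

(* Defs.v *)
From HB Require Import structures.
From mathcomp Require Import all_boot all_order all_algebra finmap.
Set Implicit Arguments.
Unset Strict Implicit.
Unset Printing Implicit Defensive.

Import GRing.Theory.

(* A structure with n binary relations, not yet required to be orders. *)
Definition nrel (n : nat) (T : Type) := 'I_n -> rel T.

Definition strict_linear_order (T : eqType) (lt : rel T) : Prop :=
  [/\ irreflexive lt, transitive lt & forall x y, x != y -> lt x y || lt y x].

Definition norder (n : nat) (T : eqType) (r : nrel n T) : Prop :=
  forall i, strict_linear_order (r i).

Definition relation_preserving (n : nat) (S T : Type)
    (s : nrel n S) (r : nrel n T) (f : S -> T) : Prop :=
  forall i x y, r i (f x) (f y) = s i x y.

Definition embedding (n : nat) (S T : Type)
    (s : nrel n S) (r : nrel n T) (f : S -> T) : Prop :=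
  injective f /\ relation_preserving s r f.

Definition isomorphism (n : nat) (S T : Type)
    (s : nrel n S) (r : nrel n T) (f : S -> T) : Prop :=
  bijective f /\ relation_preserving s r f.

Definition induced (n : nat) (T : choiceType) (r : nrel n T) (A : {fset T}) :
    nrel n A :=
  fun i x y => r i (val x) (val y).

Definition homogeneous (n : nat) (T : choiceType) (r : nrel n T) : Prop :=
  forall (A B : {fset T}) (f : A -> B),
    isomorphism (induced r (A := A)) (induced r (A := B)) f ->
    exists g : T -> T,
      isomorphism r r g /\ forall x : A, g (val x) = val (f x).

Definition in_age (n : nat) (T : Type) (r : nrel n T)
    (F : finType) (s : nrel n F) : Prop :=
  exists f : F -> T, embedding s r f.

(* By Fraisse's theorem, these conditions determine a countable n-order up to
   isomorphism; countability is carried by the type of T. *)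
Definition generic (n : nat) (T : countType) (r : nrel n T) : Prop :=
  [/\ norder r,
      homogeneous r
    & forall (F : finType) (s : nrel n F), in_age r s <-> norder s].

Definition right_invariant (G : zmodType) (lt : rel G) : Prop :=
  forall x y g : G, lt x y -> lt (x + g)%R (y + g)%R.

(* Main.v *)
Require Import Defs.
From mathcomp Require Import all_boot all_order all_algebra finmap.
From mathcomp Require Import boolp.
From mathcomp Require Import zify ring lra.

Set Implicit Arguments.
Unset Strict Implicit.
Unset Printing Implicit Defensive.

Import Order.TTheory GRing.Theory Num.Theory.

(** Both directions compare an invariant order on Z^m with a rational linear
    functional.  Finitely many positivity facts about an invariant order always
    hold for some functional too ([positive_functional], by Fourier-Motzkin
    elimination), so finitely many facts about n invariant orders are witnessed
    by one rational m x n matrix A, whose i-th column describes the i-th order.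

    If n < m, then A has a nonzero integer kernel vector z.  An arbitrarily
    small perturbation of A sends a large multiple of z to any prescribed point
    of Q^n, because the perturbation is magnified by the multiple.  Hence finite
    sets of promises of the form `z is positive in the i-th order' which some A
    satisfies can be enlarged so that any given consistent system of n cuts is
    filled ([fill_cut]).  Meeting the countably many requirements one after the
    other gives n invariant orders in which every finite system of cuts is
    filled ([invariant_orders_fill_cuts]).  Such an n-order is generic by a
    back-and-forth argument ([fills_cuts_generic]).

    If m <= n and the n-order is generic, embed one point z_s (a corner) for
    each sign vector s, together with K further points u that lie, in the i-th
    order, below the corners with s_i true and above the others.  The corners
    can be fixed before K is chosen ([generic_extends]).  Take A describing the
    orders on all these points.  A nonzero combination c of the columns of A is
    larger at the corner with the signs of c than at u ([corner_dominates]);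
    so the columns are linearly independent, they span all functionals, and
    each coordinate of u lies between coordinates of corners
    ([between_corners_bounded]).  This bound does not depend on K, but only
    finitely many integer points satisfy it. *)

(** * Meeting countably many requirements *)

(** The existence of a generic filter for countably many dense sets; it builds
    both the orders on Z^m and the automorphisms in the back-and-forth. *)
Lemma generic_chain (E : eqType) (I : countType) (P : seq E -> Prop)
    (D : I -> seq E -> Prop) (s0 : seq E) :
  P s0 ->
  (forall i s, P s -> exists t, [/\ P t, {subset s <= t} & D i t]) ->
  exists s : nat -> seq E,
    [/\ s 0 = s0, forall k, P (s k),
        forall j k, j <= k -> {subset s j <= s k}
      & forall i, exists k, D i (s k)].
Proof.
move=> Ps0 dense.
have /choice[step stepP] (u : I * seq E) : exists t, P u.2 ->
    [/\ P t, {subset u.2 <= t} & D u.1 t].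
  case: u => i s /=.
  have [/(dense i)[t] | nPs] := pselect (P s); first by exists t.
  by exists s => /nPs.
pose next k s := if choice.unpickle k is Some i then step (i, s) else s.
pose s := fix s k := if k is j.+1 then next j (s j) else s0.
have Ps k : P (s k).
  elim: k => //= k IHk; rewrite /next.
  by case: (choice.unpickle k) => // i; case: (stepP (i, _) IHk).
exists s; split=> // [j k /subnKC <- | i].
  elim: (k - j) => [|d IHd] x; first by rewrite addn0.
  rewrite addnS /= /next => /IHd sx.
  case: (choice.unpickle _) => // i.
  have [_ sub _] := stepP (i, _) (Ps (j + d)); exact: sub.
exists (choice.pickle i).+1; rewrite /= /next choice.pickleK.
by have [] := stepP (i, _) (Ps (choice.pickle i)).
Qed.

(** * Filling cuts implies genericity *)

Lemma norder_of_embedding n (F T : eqType) (s : nrel n F) (r : nrel n T) f :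
  norder r -> embedding s r f -> norder s.
Proof.
move=> rO [finj fr] i; have [irr tr tot] := rO i.
split=> [x | y x z | x y xy]; rewrite -!fr //; first exact: tr.
by apply: tot; rewrite (inj_eq finj).
Qed.

Section PartialIso.
Variables (n : nat) (hn : 0 < n).

(** Equality is definable from the orders, so relation-preserving
    correspondences are automatically functional and injective. *)
Lemma norder_eq (T : eqType) (r : nrel n T) : norder r ->
  forall x y, x = y <-> forall i, ~~ r i x y /\ ~~ r i y x.
Proof.
move=> rO x y; split=> [<- i | rxy].
  by have [irr _ _] := rO i; rewrite irr.
have [_ _ tot] := rO (Ordinal hn); have [xy yx] := rxy (Ordinal hn).
by apply: contraNeq xy => /tot; rewrite (negPf yx) orbF.
Qed.

Definition partial_iso (S T : Type) (s : nrel n S) (r : nrel n T)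
    (R : S -> T -> Prop) :=
  forall x y x' y', R x y -> R x' y' -> forall i, r i y y' = s i x x'.

Lemma partial_iso_eq (S T : eqType) (s : nrel n S) (r : nrel n T) R :
  norder s -> norder r -> partial_iso s r R ->
  forall x y x' y', R x y -> R x' y' -> x = x' <-> y = y'.
Proof.
move=> sO rO Riso x y x' y' Rxy Rxy'.
have e i := Riso _ _ _ _ Rxy Rxy' i; have e' i := Riso _ _ _ _ Rxy' Rxy i.
by split=> [/(norder_eq sO) | /(norder_eq rO)] E; apply/norder_eq=> // i;
  have := E i; rewrite e e'.
Qed.

Definition pairs (S T : eqType) (l : seq (S * T)) x y : Prop := (x, y) \in l.

(** The one-point extension property: a one-point extension of a finite n-order
    amounts to a choice of one cut in each of the n orders. *)
Definition fills_cuts (T : eqType) (r : nrel n T) :=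
  forall lo hi : {ffun 'I_n -> seq T},
    (forall i x y, x \in lo i -> y \in hi i -> r i x y) ->
  exists z, forall i, {in lo i, forall x, r i x z} /\ {in hi i, forall y, r i z y}.

(** Serves as the forth step, as the back step after swapping the roles of the
    two sides, and as the induction step of embedding a finite n-order. *)
Lemma extend_partial_iso (S T : eqType) (s : nrel n S) (r : nrel n T) l x :
  norder s -> norder r -> fills_cuts r -> partial_iso s r (pairs l) ->
  exists l', [/\ partial_iso s r (pairs l'), {subset l <= l'}
               & exists y, (x, y) \in l'].
Proof.
move=> sO rO rfill liso.
have [/mapP[[x' y] lxy /= ->] | xNl] := boolP (x \in map fst l).
  by exists l; split=> //; exists y.
pose lo := [ffun i => [seq u.2 | u <- l & s i u.1 x]].
pose hi := [ffun i => [seq u.2 | u <- l & s i x u.1]].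
have [|y yP] := rfill lo hi.
  move=> i y y'; rewrite !ffunE => /mapP[[a b] + /= ->] /mapP[[a' b'] + /= ->].
  rewrite !mem_filter /= => /andP[sax lab] /andP[sxa' lab'].
  have [_ tr _] := sO i.
  by rewrite (liso _ _ _ _ lab lab'); apply: tr sxa'.
have new a b : (a, b) \in l -> forall i, r i b y = s i a x /\ r i y b = s i x a.
  move=> lab i; have [irrs trs tots] := sO i; have [irrr trr _] := rO i.
  have [lo_y hi_y] := yP i; rewrite !ffunE in lo_y hi_y.
  have aNx : a != x by apply: contraNneq xNl => <-; apply/mapP; exists (a, b).
  have asym u v : s i u v -> s i v u = false.
    by move=> uv; apply: contraFF (irrs u) => /(trs _ _ _ uv).
  have asymr u v : r i u v -> r i v u = false.
    by move=> uv; apply: contraFF (irrr u) => /(trr _ _ _ uv).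
  have /orP[ax | xa] := tots _ _ aNx.
    have by_ : r i b y.
      by apply: lo_y; apply/mapP; exists (a, b) => //; rewrite mem_filter ax.
    by rewrite ax by_ (asym _ _ ax) (asymr _ _ by_).
  have yb : r i y b.
    by apply: hi_y; apply/mapP; exists (a, b) => //; rewrite mem_filter xa.
  by rewrite xa yb (asym _ _ xa) (asymr _ _ yb).
exists ((x, y) :: l); split; last by exists y; rewrite mem_head.
  move=> a b a' b'; rewrite /pairs !inE.
  move=> /orP[/eqP[-> ->] | lab] /orP[/eqP[-> ->] | lab'] i.
  - by have [-> _ _] := sO i; have [-> _ _] := rO i.
  - by have [] := new _ _ lab' i.
  - by have [] := new _ _ lab i.
  - exact: liso.
by move=> u lu; rewrite inE lu orbT.
Qed.

Lemma fills_cuts_embeds (F : finType) (T : eqType) (s : nrel n F) (r : nrel n T) :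
  norder s -> norder r -> fills_cuts r -> in_age r s.
Proof.
move=> sO rO rfill.
have [l liso lP] : exists2 l, partial_iso s r (pairs l) &
    forall x, x \in enum F -> exists y, (x, y) \in l.
  elim: (enum F) => [|x e [l liso lP]]; first by exists [::].
  have [l' [l'iso ll' l'x]] := extend_partial_iso x sO rO rfill liso.
  exists l' => // x'; rewrite inE => /orP[/eqP-> // | /lP[y /ll']].
  by exists y.
have /choice[f fP] x : exists y, (x, y) \in l by apply: lP; rewrite mem_enum.
exists f; split=> [x y fxy | i x y]; last exact: liso (fP x) (fP y) i.
by have [_] := partial_iso_eq sO rO liso (fP x) (fP y); apply.
Qed.

Lemma fills_cuts_homogeneous (T : countType) (r : nrel n T) :
  norder r -> fills_cuts r -> homogeneous r.
Proof.
move=> rO rfill A B f [_ fiso].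
pose graph := [seq (val x, val (f x)) | x <- enum {: A}].
(* u.1 tells whether u.2 has to be matched as an argument or as a value *)
pose total (u : bool * T) (l : seq (T * T)) :=
  exists y, (if u.1 then (u.2, y) else (y, u.2)) \in l.
have [|u l liso|s [s0 siso smono sP]] := @generic_chain _ _
    (fun l => partial_iso r r (pairs l)) total graph.
- move=> x y x' y' /mapP[a _ [-> ->]] /mapP[b _ [-> ->]] i.
  exact: fiso.
- case: u => -[] x.
    by have [l' [? ? ?]] := extend_partial_iso x rO rO rfill liso; exists l'.
  pose swap (u : T * T) := (u.2, u.1).
  have swapK : involutive swap by case.
  have swapE a b k : ((a, b) \in map swap k) = ((b, a) \in k).
    by rewrite -[(a, b)]/(swap (b, a)) (mem_map (inv_inj swapK)).
  have [|l' [l'iso ll' [y l'y]]] := @extend_partial_iso _ _ r r (map swap l) x rO rO rfill.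
    by move=> a b a' b'; rewrite /pairs !swapE => /liso li /li.
  exists (map swap l'); split; last by exists y; rewrite swapE.
    by move=> a b a' b'; rewrite /pairs !swapE => /l'iso li /li.
  by case=> a b lab; rewrite swapE ll' ?swapE.
pose R x y := exists k, (x, y) \in s k.
have Riso : partial_iso r r R.
  move=> x y x' y' [k xy] [k' xy']; apply: (siso (maxn k k')).
    exact: smono (leq_maxl _ _) _ xy.
  exact: smono (leq_maxr _ _) _ xy'.
have /choice[g gP] x : exists y, R x y.
  by have [k [y sy]] := sP (true, x); exists y, k.
have /choice[h hP] y : exists x, R x y.
  by have [k [x sx]] := sP (false, y); exists x, k.
exists g; split.
  split=> [|i x y]; last exact: Riso.
  exists h => x.
    by have [_] := partial_iso_eq rO rO Riso (hP (g x)) (gP x); apply.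
  by have [+ _] := partial_iso_eq rO rO Riso (gP (h x)) (hP x); apply.
move=> x; have gx := gP (val x).
suff Rx : R (val x) (val (f x)) by have [+ _] := partial_iso_eq rO rO Riso gx Rx; apply.
by exists 0; rewrite s0; apply/mapP; exists x; rewrite ?mem_enum.
Qed.

Lemma fills_cuts_generic (T : countType) (r : nrel n T) :
  norder r -> fills_cuts r -> generic r.
Proof.
move=> rO rfill; split=> // [|F s]; first exact: fills_cuts_homogeneous.
split=> [[f fP] | sO]; first exact: norder_of_embedding fP.
exact: fills_cuts_embeds.
Qed.

End PartialIso.

Local Open Scope ring_scope.

(** * Linear functionals on integer vectors *)

Lemma between_seqs (R : realFieldType) (L U : seq R) :
  (forall l u, l \in L -> u \in U -> l < u) ->
  exists b, {in L, forall l, l < b} /\ {in U, forall u, b < u}.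
Proof.
have above l : {in U, forall u, l < u} -> exists2 b, l < b & {in U, forall u, b < u}.
  elim: U => [|u U IHU] lU; first by exists (l + 1) => //; rewrite ltrDl.
  have lu := lU u (mem_head _ _).
  have [|b lb bU] := IHU; first by move=> v Uv; apply: lU; rewrite inE Uv orbT.
  exists (Num.min b ((l + u) / 2)).
    by rewrite lt_min lb /=; lra.
  move=> v; rewrite inE gt_min => /orP[/eqP-> | /bU->//].
  by apply/orP; right; lra.
elim: L => [_ | l L IHL LU].
  suff [b bU] : exists b, {in U, forall u, b < u} by exists b.
  elim: U {above} => [|u U [b bU]]; first by exists 0.
  exists (Num.min b (u - 1)) => v; rewrite inE gt_min => /orP[/eqP-> | /bU->//].
  by apply/orP; right; lra.
have [|b [Lb bU]] := IHL.
  by move=> l' u Ll'; apply: LU; rewrite inE Ll' orbT.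
have [lb | bl] := ltP l b.
  by exists b; split=> // l'; rewrite inE => /orP[/eqP-> | /Lb].
have [|b' lb' b'U] := above l; first by move=> u; apply: LU; rewrite mem_head.
exists b'; split=> // l'; rewrite inE => /orP[/eqP-> // | /Lb l'b].
exact: lt_trans (lt_le_trans l'b bl) lb'.
Qed.

(** The i-th column of A, as a functional on Z^m. *)
Definition lform (m n : nat) (A : 'M[rat]_(m, n)) (i : 'I_n) (x : 'rV[int]_m) : rat :=
  (map_mx intr x *m A) 0 i.

Lemma lformE m n (A : 'M[rat]_(m, n)) i x :
  lform A i x = \sum_j (x 0 j)%:~R * A j i.
Proof. by rewrite /lform mxE; apply: eq_bigr => j _; rewrite !mxE. Qed.

Lemma lformB m n (A : 'M[rat]_(m, n)) i : {morph lform A i : x y / x - y}.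
Proof. by move=> x y; rewrite /lform map_mxB mulmxBl !mxE. Qed.

Lemma lform0 m n (A : 'M[rat]_(m, n)) i : lform A i 0 = 0.
Proof. by rewrite -(subrr 0) lformB subrr. Qed.

Lemma lformD m n (A : 'M[rat]_(m, n)) i : {morph lform A i : x y / x + y}.
Proof. by move=> x y; rewrite /lform map_mxD mulmxDl !mxE. Qed.

Lemma lformN m n (A : 'M[rat]_(m, n)) i : {morph lform A i : x / - x}.
Proof. by move=> x; rewrite /lform map_mxN mulNmx !mxE. Qed.

Lemma lformMn m n (A : 'M[rat]_(m, n)) i k : {morph lform A i : x / x *+ k}.
Proof.
move=> x; elim: k => [|k IHk]; last by rewrite !mulrS lformD IHk.
by rewrite !mulr0n lform0.
Qed.

Lemma lformZ m n (A : 'M[rat]_(m, n)) i a :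
  {morph lform A i : x / a *: x >-> a%:~R * x}.
Proof. by move=> x; rewrite /lform map_mxZ -scalemxAl mxE. Qed.

Lemma lform_perturb m n (A D : 'M[rat]_(m, n)) t i x :
  lform (A + t *: D) i x = lform A i x + t * lform D i x.
Proof. by rewrite /lform mulmxDr -scalemxAr !mxE. Qed.

(** Finitely many strict inequalities survive a common small perturbation.  The
    step is 1/(N+1) because N+1 is also the multiple of the kernel vector used
    in [fill_cut]. *)
Lemma small_step (s : seq (rat * rat)) :
  {in s, forall u, 0 < u.1} ->
  exists N : nat, {in s, forall u, 0 < u.1 + N.+1%:R^-1 * u.2}.
Proof.
move=> s_gt0; suff [N NP] : exists N : nat, forall k : nat, (N <= k)%N ->
    {in s, forall u, 0 < u.1 + k.+1%:R^-1 * u.2} by exists N; apply: NP.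
elim: s s_gt0 => [|[a d] s IHs] s_gt0; first by exists 0.
have [|N NP] := IHs; first by move=> u su; apply: s_gt0; rewrite inE su orbT.
have /= a_gt0 := s_gt0 _ (mem_head _ _).
exists (maxn N (Num.bound (`|d| / a))) => k.
rewrite geq_max => /andP[Nk dk] u; rewrite inE => /orP[/eqP-> /= | /NP]; last exact.
have k_gt0 : 0 < k.+1%:R :> rat by rewrite ltr0n.
have da : `|d| / a < k.+1%:R.
  apply: lt_le_trans (archi_boundP _) _; first by rewrite divr_ge0 // ltW.
  by rewrite ler_nat ltnW.
rewrite ltr_pdivrMr // in da.
suff : 0 < k.+1%:R * (a + k.+1%:R^-1 * d) by rewrite pmulr_rgt0.
rewrite mulrDr mulVKf ?gt_eqF //.
have := ler_norm (- d); rewrite normrN; lra.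
Qed.

Lemma integer_kernel m n (A : 'M[rat]_(m, n)) : (n < m)%N ->
  exists2 z : 'rV[int]_m, z != 0 & map_mx intr z *m A = 0.
Proof.
move=> ltnm; have [|v vA vN0] := @rowV0Pn _ _ _ (kermx A) _.
  rewrite -mxrank_eq0 mxrank_ker -lt0n subn_gt0.
  exact: leq_ltn_trans (rank_leq_col A) ltnm.
pose d := \prod_j denq (v 0 j).
have dN0 : d != 0 by apply/prodf_neq0 => j _; exact: denq_neq0.
(* multiply v by the product d of all its denominators *)
have /choice[z zP] (j : 'I_m) : exists z : int, z%:~R = d%:~R * v 0 j.
  exists (numq (v 0 j) * \prod_(k | k != j) denq (v 0 k)).
  rewrite /d [in RHS](bigD1 j) //= !intrM numqE; ring.
have zE : map_mx intr (\row_j z j) = (d%:~R : rat) *: v.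
  by apply/rowP=> j; rewrite !mxE zP.
exists (\row_j z j).
  apply: contraNneq vN0 => z0; move: zE; rewrite z0 map_mx0 => /esym/eqP.
  by rewrite scaler_eq0 intr_eq0 (negPf dN0).
by rewrite zE -scalemxAl (sub_kermxP vA) scaler0.
Qed.

(** The direction of perturbation in which z moves to b. *)
Lemma lform_interpolate m n (z : 'rV[int]_m) (b : 'I_n -> rat) : z != 0 ->
  exists D : 'M[rat]_(m, n), forall i, lform D i z = b i.
Proof.
move=> /rV0Pn[j zj].
(* any coordinate j at which z does not vanish can carry all of D *)
exists (\matrix_(k, i) (if k == j then b i / (z 0 j)%:~R else 0)) => i.
rewrite lformE (bigD1 j) //= big1 => [|k /negPf kj]; last by rewrite mxE kj mulr0.
by rewrite mxE eqxx addr0 mulrC divfK // intr_eq0.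
Qed.

(** * Invariant orders that fill all cuts *)

(** A pair (i, z) is the promise that z will be positive in the i-th order. *)
Definition positive m n (A : 'M[rat]_(m, n)) (p : seq ('I_n * 'rV[int]_m)) :=
  {in p, forall c, 0 < lform A c.1 c.2}.

Definition satisfiable m n (p : seq ('I_n * 'rV[int]_m)) :=
  exists A : 'M[rat]_(m, n), positive A p.

(** If z has value 0, a perturbation in a direction with value 1 at z breaks the
    tie and is small enough to keep p. *)
Lemma decide_sign m n (p : seq ('I_n * 'rV[int]_m)) i z :
  satisfiable p -> z != 0 ->
  satisfiable ((i, z) :: p) \/ satisfiable ((i, - z) :: p).
Proof.
move=> [A Ap] zN0.
have cons B x : positive B p -> 0 < lform B i x -> positive B ((i, x) :: p).
  by move=> Bp Bx c; rewrite inE => /orP[/eqP-> | /Bp].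
have [Az | Az | Az0] := ltgtP 0 (lform A i z).
- by left; exists A; apply: cons.
- by right; exists A; apply: cons => //; rewrite lformN oppr_gt0.
have [D Dz] := @lform_interpolate m n z (fun=> 1) zN0.
have [|N NP] := @small_step [seq (lform A c.1 c.2, lform D c.1 c.2) | c <- p].
  by move=> u /mapP[c pc ->] /=; apply: Ap.
left; exists (A + N.+1%:R^-1 *: D); apply: cons => [c pc|]; rewrite lform_perturb.
  by apply: (NP (_, _)); apply/mapP; exists c.
by rewrite -Az0 Dz add0r mulr1 invr_gt0 ltr0n.
Qed.

Definition cut_constraints m n (lo hi : {ffun 'I_n -> seq 'rV[int]_m}) z :=
  [seq (i, z - x) | i <- enum 'I_n, x <- lo i] ++
  [seq (i, y - z) | i <- enum 'I_n, y <- hi i].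

(** Pick a target value b_i inside the cut that the i-th column of A makes in
    lo i and hi i.  A kernel vector z of A, which exists because n < m, is moved
    by A + D/(N+1) to b/(N+1), so (N+1) z lands on b, while for large N the
    perturbed matrix keeps all the promises and still has b inside the cuts. *)
Lemma fill_cut m n (p : seq ('I_n * 'rV[int]_m))
    (lo hi : {ffun 'I_n -> seq 'rV[int]_m}) (A : 'M[rat]_(m, n)) :
  (n < m)%N -> positive A p ->
  (forall i x y, x \in lo i -> y \in hi i -> 0 < lform A i (y - x)) ->
  exists z : 'rV[int]_m, satisfiable (cut_constraints lo hi z ++ p).
Proof.
move=> ltnm Ap loAhi.
have /choice[b bP] i : exists b, {in lo i, forall x, lform A i x < b} /\
                                 {in hi i, forall y, b < lform A i y}.
  have [|b [lob bhi]] := @between_seqs _ (map (lform A i) (lo i)) (map (lform A i) (hi i)).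
    move=> _ _ /mapP[x lox ->] /mapP[y hiy ->].
    by have := loAhi i x y lox hiy; rewrite lformB subr_gt0.
  by exists b; split=> x ?; [apply: lob | apply: bhi]; apply: map_f.
have [z zN0 zA0] := integer_kernel A ltnm.
have [D Dz] := lform_interpolate b zN0.
(* values and slopes along D of everything that has to remain positive: the
   promises in p and the distances from b to both sides of the cuts *)
pose s := [seq (lform A c.1 c.2, lform D c.1 c.2) | c <- p] ++
  ([seq (b i - lform A i x, - lform D i x) | i <- enum 'I_n, x <- lo i] ++
   [seq (lform A i y - b i, lform D i y) | i <- enum 'I_n, y <- hi i]).
have [|N NP] := @small_step s.
  move=> u; rewrite !mem_cat => /orP[/mapP[c pc ->] | /orP[]]; first exact: Ap.
    by case/allpairsPdep=> i [x [_ lox ->]] /=; rewrite subr_gt0; apply: (bP i).1.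
  by case/allpairsPdep=> i [x [_ hix ->]] /=; rewrite subr_gt0; apply: (bP i).2.
have Nz i : lform (A + N.+1%:R^-1 *: D) i (z *+ N.+1) = b i.
  rewrite lform_perturb !lformMn Dz [lform A i z]/lform zA0 mxE mul0rn add0r.
  by rewrite -[b i *+ _]mulr_natl mulKf // pnatr_eq0.
exists (z *+ N.+1), (A + N.+1%:R^-1 *: D) => c.
rewrite !mem_cat => /orP[/orP[] | pc]; last first.
- rewrite lform_perturb; apply: (NP (_, _)).
  by rewrite mem_cat; apply/orP; left; apply/mapP; exists c.
- case/allpairsPdep=> i [y [_ hiy ->]] /=; rewrite lformB Nz lform_perturb.
  rewrite addrAC; apply: (NP (_, _)); rewrite !mem_cat; apply/orP; right.
  by apply/orP; right; apply/allpairsPdep; exists i, y; rewrite mem_enum.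
- case/allpairsPdep=> i [x [_ lox ->]] /=; rewrite lformB Nz lform_perturb.
  rewrite opprD addrA -mulrN; apply: (NP (_, _)); rewrite !mem_cat; apply/orP; right.
  by apply/orP; left; apply/allpairsPdep; exists i, x; rewrite mem_enum.
Qed.

(** There are two kinds of requirements: every nonzero z gets a sign in every
    order, and every system of cuts is either filled or refuted by the promises
    made so far.  A system that is consistent in the final orders is consistent
    already with a finite set of promises, hence it is never refuted. *)
Lemma invariant_orders_fill_cuts m n : (n < m)%N ->
  exists r : nrel n 'rV[int]_m,
    [/\ norder r, forall i, right_invariant (r i) & fills_cuts r].
Proof.
move=> ltnm.
pose requirement := (('I_n * 'rV[int]_m) +
  {ffun 'I_n -> seq 'rV[int]_m} * {ffun 'I_n -> seq 'rV[int]_m})%type.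
pose meets (c : requirement) (q : seq ('I_n * 'rV[int]_m)) := match c with
  | inl (i, z) => z != 0 -> (i, z) \in q \/ (i, - z) \in q
  | inr (lo, hi) =>
      (exists z, {subset cut_constraints lo hi z <= q}) \/
      (forall A, positive A q ->
         ~ forall i x y, x \in lo i -> y \in hi i -> 0 < lform A i (y - x))
  end.
have [||s [_ sat mono sP]] := @generic_chain _ _ (@satisfiable m n) meets [::].
- by exists 0.
- case=> [[i z] | [lo hi]] p psat.
    have [-> | zN0] := eqVneq z 0; first by exists p; split=> //=; rewrite eqxx.
    have [qsat|qsat] := decide_sign i psat zN0.
      exists ((i, z) :: p); split=> // [c|_]; first by rewrite inE orbC => ->.
      by left; rewrite mem_head.
    exists ((i, - z) :: p); split=> // [c|_]; first by rewrite inE orbC => ->.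
    by right; rewrite mem_head.
  have [[A Ap loAhi] | none] := pselect (exists2 A : 'M[rat]_(m, n), positive A p &
      forall i x y, x \in lo i -> y \in hi i -> 0 < lform A i (y - x)).
    have [z zsat] := fill_cut ltnm Ap loAhi.
    exists (cut_constraints lo hi z ++ p).
    split=> // [c pc|]; first by rewrite mem_cat pc orbT.
    by left; exists z => c zc; rewrite mem_cat zc.
  by exists p; split=> //; right => A Ap loAhi; apply: none; exists A.
pose P i z := exists k, (i, z) \in s k.
have model (cs : seq ('I_n * 'rV[int]_m)) : (forall c, c \in cs -> P c.1 c.2) -> forall k,
    exists k', [/\ (k <= k')%N & {subset cs <= s k'}].
  elim: cs => [|[i z] cs IHcs] csP k; first by exists k.
  have [l zl] : exists l, (i, z) \in s l := csP (i, z) (mem_head _ _).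
  have [|k' [lek' sub]] := IHcs _ (maxn k l).
    by move=> c cc; apply: csP; rewrite inE cc orbT.
  rewrite geq_max in lek'; case/andP: lek' => kk' lk'.
  exists k'; split=> // c; rewrite inE => /orP[/eqP-> | /sub//].
  exact: mono lk' _ zl.
(* finitely many positivity facts always have a common matrix model, so the
   properties of the positive cones can be read off from matrices *)
have PA (cs : seq ('I_n * 'rV[int]_m)) : (forall c, c \in cs -> P c.1 c.2) ->
    exists A : 'M[rat]_(m, n), positive A cs.
  move=> csP; have [k [_ sub]] := model cs csP 0%N; have [A Ap] := sat k.
  by exists A => c /sub/Ap.
have Ptot i z : z != 0 -> P i z \/ P i (- z).
  move=> zN0; have [k /(_ zN0)[zk | zk]] := sP (inl (i, z)).
    by left; exists k.
  by right; exists k.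
have P0 i : ~ P i 0.
  move=> Pi0; have [|A /(_ _ (mem_head _ _))] := PA [:: (i, 0)].
    by move=> c; rewrite inE => /eqP->.
  by rewrite lform0 ltxx.
have PD i x y : P i x -> P i y -> P i (x + y).
  move=> Px Py; have Axy cs : (forall c, c \in cs -> P c.1 c.2) ->
      exists A, positive A cs /\ 0 < lform A i (x + y).
    move=> csP; have [|A Acs] := PA ((i, x) :: (i, y) :: cs).
      by move=> c; rewrite !inE => /or3P[/eqP->|/eqP->|/csP].
    exists A; split=> [c cc|]; first by apply: Acs; rewrite !inE cc !orbT.
    by rewrite lformD addr_gt0 ?(Acs (i, x)) ?(Acs (i, y)) // !inE eqxx ?orbT.
  have [/eqP|/(Ptot i)[]// Pxy] := boolP (x + y == 0).
    by move=> xy0; have [//|A [_]] := Axy [::]; rewrite xy0 lform0 ltxx.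
  have [c|A [/(_ _ (mem_head _ _))]] := Axy [:: (i, - (x + y))].
    by rewrite inE => /eqP->.
  by rewrite lformN oppr_gt0 => /lt_trans lt0 /lt0; rewrite ltxx.
pose r : nrel n 'rV[int]_m := fun i x y => `[< P i (y - x) >].
exists r; split.
- move=> i; split=> [x | y x z | x y xy].
  + by apply/asboolP; rewrite subrr; apply: P0.
  + move=> /asboolP Pxy /asboolP Pyz; apply/asboolP.
    by rewrite -[z](subrK y) -addrA; apply: PD.
  + have [|Pyx|Pxy] := Ptot i (y - x); first by rewrite subr_eq0 eq_sym.
      by apply/orP; left; apply/asboolP.
    by apply/orP; right; apply/asboolP; rewrite opprB in Pxy.
- by move=> i x y g; rewrite /r opprD addrACA subrr addr0.
move=> lo hi lohi; have [k [[z zk] | none]] := sP (inr (lo, hi)).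
  exists z => i; split=> x xi; apply/asboolP; exists k; apply: zk.
    by rewrite mem_cat; apply/orP; left; apply/allpairsPdep; exists i, x; rewrite mem_enum.
  by rewrite mem_cat; apply/orP; right; apply/allpairsPdep; exists i, x; rewrite mem_enum.
(* refuted requirement: the promises that make the cuts consistent all belong to
   one stage of the chain, whose model contradicts the refutation *)
pose cs := [seq (i, xy.2 - xy.1) | i <- enum 'I_n,
                                   xy <- [seq (x, y) | x <- lo i, y <- hi i]].
have [|k' [kk' sub]] := model cs _ k.
  by move=> c /allpairsPdep[i [_ [_ /allpairsP[[x y] [xi yi ->]] ->]]]; apply/asboolP/lohi.
have [A Ap] := sat k'; case: (none A) => [c /(mono _ _ kk')/Ap // | i x y xi yi].
apply: (Ap (i, y - x)); apply: sub; apply/allpairsPdep; exists i, (x, y).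
by split; rewrite ?mem_enum //; apply/allpairsP; exists (x, y).
Qed.

(** * Bounded sandwiched points when m <= n *)

(** Embed the larger structure anywhere, then use homogeneity to move the copy
    of the smaller one onto the prescribed one. *)
Lemma generic_extends n (T : countType) (r : nrel n T) (F0 F : finType)
    (s : nrel n F) (j : F0 -> F) (f0 : F0 -> T) :
  generic r -> norder s -> injective j ->
  embedding (fun i x y => s i (j x) (j y)) r f0 ->
  exists2 f, embedding s r f & forall x, f (j x) = f0 x.
Proof.
move=> [_ rhom rage] sO jinj [f0inj f0r].
have [h [hinj hr]] := (rage F s).2 sO.
pose A := [fset h (j x) | x in F0]%fset; pose B := [fset f0 x | x in F0]%fset.
have hA x : h (j x) \in A by apply/imfsetP; exists x.
have fB x : f0 x \in B by apply/imfsetP; exists x.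
have /choice[a aP] (u : A) : exists x, val u = h (j x).
  by have /imfsetP[x _ e] := valP u; exists x.
have /choice[b bP] (v : B) : exists x, val v = f0 x.
  by have /imfsetP[x _ e] := valP v; exists x.
pose phi u : B := [` fB (a u)]%fset; pose psi v : A := [` hA (b v)]%fset.
have [|g [[gbij gr] gphi]] := rhom A B phi.
  split.
    exists psi => u; apply: val_inj => /=.
      rewrite aP; congr (h (j _)); apply: f0inj.
      by rewrite -bP.
    rewrite bP; congr (f0 _); apply: jinj; apply: hinj.
    by rewrite -aP.
  by move=> i x y; rewrite /induced /= f0r !aP hr.
exists (g \o h) => [|x /=].
  by split=> [|i x y /=]; [apply: inj_comp => //; exact: bij_inj | rewrite gr hr].
have := gphi [` hA x]%fset; rewrite /= => ->.
by congr f0; apply: jinj; apply: hinj; rewrite -aP.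
Qed.

(** Gordan's alternative for the positive cone P of an invariant order, by
    Fourier-Motzkin elimination of the first coordinate: two vectors
    whose first coordinates have opposite signs have a positive combination with
    first coordinate 0, which again lies in P, and positivity of a functional on
    these combinations says that the lower and upper bounds on its value at the
    first basis vector are compatible. *)
Lemma positive_functional m (P : 'rV[int]_m -> Prop) (S : seq 'rV[int]_m) :
  (forall x y, P x -> P y -> P (x + y)) -> ~ P 0 -> {in S, forall x, P x} ->
  exists g : 'cV[rat]_m, {in S, forall x, 0 < lform g 0 x}.
Proof.
elim: m => [|m IHm] in P S * => PD P0 SP.
  exists 0 => x Sx; case: P0; rewrite -[0](_ : x = _); first exact: SP.
  by apply/rowP => -[].
have PZ k x : 0 < k -> P x -> P (k *: x).
  case: k => // -[//|k] _ Px; rewrite -natz scaler_nat.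
  by elim: k => [//|k IHk]; rewrite mulrS; apply: PD.
pose e (x : 'rV[int]_m.+1) : int := x 0 0.
pose t (x : 'rV[int]_m.+1) : 'rV[int]_m := rsubmx (x : 'rV_(1 + m)).
pose Q (v : 'rV[int]_m) := P (row_mx (0 : 'rV_1) v).
have et x : x = row_mx (e x)%:M (t x).
  rewrite -[LHS](@hsubmxK _ 1 1 m x) [X in row_mx X _]mx11_scalar; congr (row_mx _%:M _).
  by rewrite mxE /e; congr (x _ _); apply: val_inj.
have Qe0 x : P x -> e x = 0 -> Q (t x).
  by move=> Px x0; have := et x; rewrite x0 raddf0 /Q => <-.
pose S' := [seq t x | x <- S & e x == 0] ++
  [seq e x *: t y - e y *: t x | x <- [seq x <- S | 0 < e x], y <- [seq y <- S | e y < 0]].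
have [|||g gP] := IHm Q S'.
- by move=> u v Qu Qv; rewrite /Q -[0](addr0 0) -add_row_mx; apply: PD.
- by rewrite /Q row_mx0.
- move=> v; rewrite mem_cat => /orP[/mapP[x + ->]|].
    by rewrite mem_filter => /andP[/eqP x0 /SP Px]; apply: Qe0.
  case/allpairsP=> -[x y] /= [+ + ->]; rewrite !mem_filter.
  move=> /andP[x_gt0 /SP Px] /andP[y_lt0 /SP Py].
  rewrite /Q; have -> : row_mx (0 : 'rV_1) (e x *: t y - e y *: t x) = e x *: y + (- e y) *: x.
    transitivity (e x *: row_mx (e y)%:M (t y) - e y *: row_mx (e x)%:M (t x)
      : 'rV_(1 + m)).
      rewrite !scale_row_mx opp_row_mx add_row_mx.
      by rewrite !scale_scalar_mx [e y * _]mulrC subrr.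
    by rewrite -!et scaleNr.
  by apply: PD; apply: PZ; rewrite ?oppr_gt0.
have form_t x b : lform (col_mx b%:M g : 'cV_m.+1) 0 x = (e x)%:~R * b + lform g 0 (t x).
  transitivity ((map_mx intr (row_mx (e x)%:M (t x)) *m col_mx b%:M g) 0 0).
    by rewrite /lform {1}(et x).
  rewrite map_row_mx mul_row_col map_scalar_mx.
  by rewrite mxE -scalar_mxM mxE mulr1n.
have [|b [b_gt b_lt]] := @between_seqs _
   [seq - lform g 0 (t x) / (e x)%:~R | x <- [seq x <- S | 0 < e x]]
   [seq - lform g 0 (t y) / (e y)%:~R | y <- [seq y <- S | e y < 0]].
  move=> _ _ /mapP[x xS ->] /mapP[y yS ->].
  move: xS yS; rewrite !mem_filter => /andP[x_gt0 Sx] /andP[y_lt0 Sy].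
  have := gP (e x *: t y - e y *: t x); rewrite mem_cat lformB !lformZ => /(_ _).
  rewrite -(ltr0z rat) in x_gt0; rewrite -(ltrz0 rat) in y_lt0.
  rewrite ltr_pdivrMr // mulrAC ltr_ndivlMr // => gxy.
  suff : 0 < (e x)%:~R * lform g 0 (t y) - (e y)%:~R * lform g 0 (t x) by lra.
  apply: gxy; apply/orP; right; apply/allpairsP; exists (x, y).
  by split; rewrite ?mem_filter /= -1?(ltr0z rat) -1?(ltrz0 rat) ?x_gt0 ?y_lt0.
exists (col_mx b%:M g : 'cV_m.+1) => x Sx; rewrite form_t.
have [x_lt0 | x_gt0 | x0] := ltgtP (e x) 0.
- have /b_lt : - lform g 0 (t x) / (e x)%:~R \in
      [seq - lform g 0 (t y) / (e y)%:~R | y <- [seq y <- S | e y < 0]].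
    by apply: map_f; rewrite mem_filter x_lt0.
  by rewrite -(ltrz0 rat) in x_lt0; rewrite ltr_ndivlMr //; lra.
- have /b_gt : - lform g 0 (t x) / (e x)%:~R \in
      [seq - lform g 0 (t y) / (e y)%:~R | y <- [seq y <- S | 0 < e y]].
    by apply: map_f; rewrite mem_filter x_gt0.
  by rewrite -(ltr0z rat) in x_gt0; rewrite ltr_pdivrMr //; lra.
rewrite x0 mulr0z mul0r add0r; apply: gP; rewrite mem_cat; apply/orP; left.
by apply/mapP; exists x; rewrite ?mem_filter ?x0.
Qed.

Section NotGeneric.
Variables (m n : nat).

Definition ncorners : nat := #|{: {ffun 'I_n -> bool}}|.

Definition corner_rank (sg : {ffun 'I_n -> bool}) : nat := enum_rank sg.

Lemma corner_rank_lt sg : (corner_rank sg < ncorners)%N.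
Proof. exact: ltn_ord. Qed.

Lemma corner_rank_inj : injective corner_rank.
Proof. exact: inj_comp val_inj enum_rank_inj. Qed.

(** In every order the inner points have to separate the corners according to
    their sign for that order; ranks only break ties among corners. *)
Definition rank_key (K : nat) (i : 'I_n) (x : {ffun 'I_n -> bool} + 'I_K) : nat :=
  match x with
  | inl sg => ((if sg i then ncorners + K else 0) + corner_rank sg)%N
  | inr k => (ncorners + k)%N
  end.

Definition sandwich K : nrel n ({ffun 'I_n -> bool} + 'I_K) :=
  fun i x y => (rank_key i x < rank_key i y)%N.

Lemma sandwich_norder K : norder (@sandwich K).
Proof.
move=> i; split=> [x | y x z | x y].
- by rewrite /sandwich ltnn.
- exact: ltn_trans.
rewrite /sandwich -neq_ltn; apply: contraNneq; case: x y => [sg|k] [tau|l] /=.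
- move=> e; apply/eqP; congr inl; apply: corner_rank_inj.
  have := corner_rank_lt sg; have := corner_rank_lt tau.
  by move: e; case: (sg i); case: (tau i); lia.
- have := corner_rank_lt sg; have := ltn_ord l.
  by case: (sg i); lia.
- have := corner_rank_lt tau; have := ltn_ord k.
  by case: (tau i); lia.
- by move=> /addnI e; apply/eqP; congr inr; apply: val_inj.
Qed.

(** Because of this the corners can be placed before the number of inner points is
    chosen. *)
Lemma sandwich_corners K i (sg tau : {ffun 'I_n -> bool}) :
  @sandwich K i (inl sg) (inl tau) = @sandwich 0 i (inl sg) (inl tau).
Proof.
rewrite /sandwich /=.
have := corner_rank_lt sg; have := corner_rank_lt tau.
by case: (sg i); case: (tau i) => /=; lia.
Qed.

Lemma invariant_pos (lt : rel 'rV[int]_m) : right_invariant lt ->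
  forall x y, lt x y -> lt 0 (y - x).
Proof. by move=> inv x y /(inv _ _ (- x)); rewrite subrr. Qed.

Lemma invariant_functional (lt : rel 'rV[int]_m) (S : seq 'rV[int]_m) :
  strict_linear_order lt -> right_invariant lt ->
  exists g : 'cV[rat]_m,
    {in S &, forall x y, lt x y -> lform g 0 x < lform g 0 y}.
Proof.
move=> [irr tr _] inv.
have [|||g gP] := @positive_functional m (lt 0)
    [seq y - x | x <- S, y <- [seq y <- S | lt x y]].
- move=> x y x_gt0 /(inv _ _ x); rewrite add0r addrC; exact: tr.
- by rewrite irr.
- move=> _ /allpairsPdep[x [y [_ + ->]]]; rewrite mem_filter => /andP[xy _].
  exact: invariant_pos.
exists g => x y Sx Sy xy; rewrite -subr_gt0 -lformB; apply: gP.
by apply/allpairsPdep; exists x, y; rewrite mem_filter xy.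
Qed.

(** At the corner with the signs of c every term of the sum is nonnegative, and
    the terms with c_i nonzero are positive. *)
Lemma corner_dominates (A : 'M[rat]_(m, n)) (z : {ffun 'I_n -> bool} -> 'rV[int]_m) u :
  (forall i (sg : {ffun 'I_n -> bool}),
     if sg i then lform A i u < lform A i (z sg)
     else lform A i (z sg) < lform A i u) ->
  forall c : 'rV[rat]_n, c != 0 ->
  exists sg, 0 < \sum_i c 0 i * lform A i (z sg - u).
Proof.
move=> Az c /rV0Pn[j cj]; exists [ffun i => 0 < c 0 i].
have term i : 0 <= c 0 i * lform A i (z [ffun i => 0 < c 0 i] - u) ?= iff (c 0 i == 0).
  have := Az i [ffun i => 0 < c 0 i]; rewrite ffunE lformB.
  set d := lform A i (z _) => dP; split.
    case: ltP dP => ci dP; first by rewrite mulr_ge0 ?subr_ge0 ?(ltW ci) ?(ltW dP).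
    by rewrite mulr_le0 // subr_le0 ltW.
  rewrite eq_sym mulf_eq0 subr_eq0 orbC; case: eqP => // e.
  by move: dP; rewrite e ltxx if_same.
rewrite lt_def sumr_ge0 => [|i _]; last exact: (term i).1.
rewrite andbT psumr_neq0 => [|i _]; last exact: (term i).1.
by apply/hasP; exists j; rewrite ?mem_index_enum //= lt_def (term j).1 eq_sym (term j).2 cj.
Qed.

Lemma lform_comb (A : 'M[rat]_(m, n)) (c : 'rV[rat]_n) x :
  \sum_i c 0 i * lform A i x = (c *m A^T *m (map_mx intr x)^T) 0 0.
Proof.
rewrite -mulmxA -trmx_mul mxE; apply: eq_bigr => i _.
by rewrite mxE.
Qed.

(** By [corner_dominates] no nonzero combination of the n columns of A vanishes,
    so they span the functionals on Q^m as m <= n.  Writing the j-th coordinate,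
    and its opposite, as such a combination gives the two corners. *)
Lemma between_corners_bounded (A : 'M[rat]_(m, n)) (z : {ffun 'I_n -> bool} -> 'rV[int]_m) u :
  (m <= n)%N ->
  (forall i (sg : {ffun 'I_n -> bool}),
     if sg i then lform A i u < lform A i (z sg)
     else lform A i (z sg) < lform A i u) ->
  forall j, (exists sg, u 0 j < z sg 0 j) /\ (exists sg, z sg 0 j < u 0 j).
Proof.
move=> lemn /corner_dominates dom j.
have free : row_free A^T.
  apply: inj_row_free => c cA0; apply/eqP; apply: contraTT isT => /dom[sg].
  by rewrite lform_comb cA0 mul0mx mxE ltxx.
have full : row_full A^T.
  rewrite /row_full eqn_leq rank_leq_col (leq_trans lemn) //.
  by move: free; rewrite /row_free => /eqP->.
have [B BA] := row_fullP full.
have coord (s : rat) (x : 'rV[int]_m) :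
    (s *: row j B *m A^T *m (map_mx intr x)^T) 0 0 = s * (x 0 j)%:~R.
  by rewrite -2!scalemxAl -row_mul BA -row_mul mul1mx !mxE.
have cN0 s : s != 0 -> s *: row j B != 0.
  move=> sN0; apply: contraNneq sN0 => c0.
  have := coord s (const_mx 1); rewrite c0 !mul0mx !mxE mulr1 => <-; exact: eqxx.
split.
  have [//|sg] := dom (1 *: row j B); first by rewrite cN0 ?oner_eq0.
  by rewrite lform_comb coord mul1r ltr0z !mxE subr_gt0; exists sg.
have [//|sg] := dom (-1 *: row j B); first by rewrite cN0 // oppr_eq0 oner_eq0.
by rewrite lform_comb coord mulN1r oppr_gt0 ltrz0 !mxE subr_lt0; exists sg.
Qed.

(** The corners z are embedded first; they bound the coordinates of all points
    between them by M.  Asking for more inner points than the box of radius M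
    contains gives a contradiction. *)
Lemma invariant_generic_lt (r : nrel n 'rV[int]_m) :
  (forall i, right_invariant (r i)) -> generic r -> (n < m)%N.
Proof.
move=> inv gen; rewrite ltnNge; apply/negP=> lemn.
have [rO _ rage] := gen.
have [h0 [h0inj h0r]] := (rage _ _).2 (@sandwich_norder 0).
pose z (sg : {ffun 'I_n -> bool}) : 'rV[int]_m := h0 (inl sg).
pose M : nat := \max_sg \max_j absz (z sg 0%R j).
have zM sg j : (absz (z sg 0%R j) <= M)%N.
  by apply: leq_trans (leq_bigmax sg); apply: (leq_bigmax (F := fun j => absz (z sg 0 j))).
pose box := {ffun 'I_m -> 'I_(M + M).+1}.
pose K := #|{: box}|.+1.
have [||f [finj fr] fz] := @generic_extends _ _ _ _ _ (@sandwich K) inl z gen (@sandwich_norder K).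
- by move=> x y [].
- split=> [x y /h0inj[] // | i x y]; by rewrite sandwich_corners h0r.
(* one matrix that describes the orders on the whole embedded structure *)
pose S := [seq f x | x : {ffun 'I_n -> bool} + 'I_K].
have /choice[g gP] i := invariant_functional S (rO i) (inv i).
pose A : 'M[rat]_(m, n) := \matrix_(j, i) g i j 0.
have Ag i x : lform A i x = lform (g i) 0 x.
  by rewrite !lformE; apply: eq_bigr => j _; rewrite mxE.
have mono i x y : @sandwich K i x y -> lform A i (f x) < lform A i (f y).
  by rewrite !Ag => xy; apply: gP; rewrite ?fr // map_f // mem_enum.
have bound k j : - M%:Z <= f (inr k) 0 j <= M%:Z.
  have [|[sg lt] [tau gt]] := @between_corners_bounded A z (f (inr k)) lemn _ j.
    move=> i sg; rewrite -fz; case sgi: (sg i); apply: mono; rewrite /sandwich /= sgi.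
      by have := ltn_ord k; lia.
    by have := corner_rank_lt sg; lia.
  move: lt gt (zM sg j) (zM tau j).
  move: (z sg 0 j) (z tau 0 j) (f (inr k) 0 j) => a b c; lia.
pose code k : box := [ffun j => inord (absz (f (inr k) 0 j + M%:Z))].
suff /leq_card : injective code by rewrite card_ord ltnn.
move=> k l /ffunP e; suff /finj[] : f (inr k) = f (inr l) by [].
apply/rowP=> j; have := congr1 val (e j); rewrite !ffunE /=.
move: (f (inr k) 0 j) (f (inr l) 0 j) (bound k j) (bound l j) => a b ak bl.
by rewrite !inordK; lia.
Qed.

End NotGeneric.

Local Close Scope ring_scope.

Theorem theorem4p1 (m n : nat) (hm : 0 < m) (hn : 0 < n) :
  (exists r : nrel n 'rV[int]_m,
      [/\ norder r, forall i : 'I_n, right_invariant (r i) & generic r])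
  <-> n < m.
Proof.
split=> [[r [_ inv gen]] | ltnm]; first exact: invariant_generic_lt inv gen.
have [r [rO inv fill]] := invariant_orders_fill_cuts ltnm.
by exists r; split=> //; exact: fills_cuts_generic.
Qed.
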